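(* Let $n\ge1$, $e\ge 0$ and $t>1$ be integers and $q=(2e+1)t$ with $(2e+1)^{n-1}\mid t$. Let $f(x)=\frac{1}{(1-x)(1-x^2)\cdots(1-x^n)}$, let $[x^m]f(x)$ denote the coefficient of $x^m$ in the power series of $f$, and let $\nu_p(m)$ denote the exponent of the prime $p$ in the prime factorization of $m$. Then the number of isomorphism classes of perfect codes in $LPL^{\infty}(n,e,q)$ is $$\prod_{p\mid 2e+1}[x^{n\nu_p(2e+1)}]f(x),$$ the product being over primes $p$ dividing $2e+1$. In particular, for $n=2$ this number is $$\prod_p[x^{2\nu_p(2e+1)}]\frac{1}{(1-x)(1-x^2)}=\prod_p(\nu_p(2e+1)+1)=\sigma_0(2e+1),$$ the number of divisors of $2e+1$. For $n=3$ this number is $$\prod_p[x^{3\nu_p(2e+1)}]\frac{1}{(1-x)(1-x^2)(1-x^3)}=\prod_p\left\lceil \tfrac34(\nu_p(2e+1)+1)^2\right\rfloor,$$ where $\lceil x\rfloor$ denotes the nearest integer to $x$; in particular, when $2e+1$ is square-free this number (for $n=3$) is $3^{\omega(2e+1)}$, where $\omega(m)$ is the number of distinct prime divisors of $m$.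
   Context: For $a\in\mathbb{Z}_q$ with representative $\tilde a\in\{0,\dots,q-1\}$ put $|a|_1=\min\{\tilde a,q-\tilde a\}$. The maximum metric on $\mathbb{Z}_q^n$ is $d(x,y)=\max_i|x_i-y_i|_1$, and $B(x,r)=\{y\in\mathbb{Z}_q^n: d(x,y)\le r\}$. $LPL^{\infty}(n,e,q)$ is the set of linear perfect codes with packing radius $e$, i.e. of subgroups $C$ of $(\mathbb{Z}_q^n,+)$ with $\#C>1$ such that $\mathbb{Z}_q^n$ is the disjoint union of the balls $B(c,e)$, $c\in C$. Isomorphism classes of codes are the classes of the relation: $C_1\sim C_2$ if $C_1=f(C_2)$ for some group automorphism $f$ of $\mathbb{Z}_q^n$. *)

(* Defs.v *)
From HB Require Import structures.
From mathcomp Require Import all_boot all_order all_fingroup all_algebra.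
From mathcomp Require Import lra.

Set Implicit Arguments.
Unset Strict Implicit.
Unset Printing Implicit Defensive.

Import Order.TTheory GRing.Theory Num.Theory.

Local Open Scope ring_scope.

Section Codes.

(* 'Z_q is the ring of integers mod q only when 1 < q. *)
Variables (q n : nat).
Local Notation V := 'rV['Z_q]_n.

Definition lee_abs (a : 'Z_q) : nat := minn a (q - a)%N.

Definition max_dist (x y : V) : nat :=
  (\max_(i < n) lee_abs (x 0 i - y 0 i)%R)%N.

Definition max_ball (x : V) (r : nat) : {set V} :=
  [set y : V | (max_dist x y <= r)%N].

(* The finite group structure on V is the additive one, so {group V} is the
   type of the subgroups of ((Z/qZ)^n, +). *)
Definition is_perfect_code (e : nat) (C : {group V}) : bool :=
  [&& (1 < #|C|)%N,
      \bigcup_(c in C) max_ball c e == [set: V]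
    & [forall c in C, forall c' in C,
        (c != c') ==> [disjoint max_ball c e & max_ball c' e]]].

Definition code_iso (C1 C2 : {group V}) : bool :=
  [exists f : {perm V},
    (f \in Aut [set: V]) && ((C1 : {set V}) == [set f x | x in C2])].

End Codes.

Definition LPL (n e q : nat) : {set {group 'rV['Z_q]_n}} :=
  [set C | is_perfect_code e C].

Definition code_classes (n e q : nat) : {set {set {group 'rV['Z_q]_n}}} :=
  equivalence_partition (@code_iso q n) (LPL n e q).

Lemma code_iso_equiv (q n : nat) : equivalence_rel (@code_iso q n).
Proof.
have refl : reflexive (@code_iso q n).
  move=> C; apply/existsP; exists 1%g; rewrite group1 /=; apply/eqP.
  by rewrite (eq_imset _ (perm1 (T := _))) imset_id.
have sym C1 C2 : code_iso C1 C2 -> code_iso (q := q) (n := n) C2 C1.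
  move=> /existsP[f /andP[fA /eqP E]]; apply/existsP; exists f^-1%g.
  rewrite groupV fA E -imset_comp; apply/eqP.
  by rewrite (eq_imset _ (g := id)) ?imset_id // => x /=; rewrite permK.
have trans C1 C2 C3 : code_iso C1 C2 -> code_iso C2 C3 ->
    code_iso (q := q) (n := n) C1 C3.
  move=> /existsP[f /andP[fA /eqP E]] /existsP[g /andP[gA /eqP F]].
  apply/existsP; exists (g * f)%g; rewrite groupM //= E F -imset_comp.
  by apply/eqP/eq_imset => x /=; rewrite permM.
move=> C1 C2 C3; split; first exact: refl.
move=> C12; apply/idP/idP; last exact: trans.
exact: trans (sym _ _ C12).
Qed.

(* Formal power series are coefficient sequences nat -> R. *)
Section PowerSeries.

Variable R : comUnitRingType.

Definition series_of_poly (p : {poly R}) : nat -> R := fun i => p`_i.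

Definition series_mul (a b : nat -> R) : nat -> R :=
  fun m => \sum_(k < m.+1) a k * b (m - k)%N.

Definition series_one : nat -> R := fun m => (m == 0)%N%:R.

(* The first m coefficients of 1 / a, solved for one by one from a * b = 1. *)
Fixpoint series_inv_prefix (a : nat -> R) (m : nat) : seq R :=
  if m is m'.+1 then
    let b := series_inv_prefix a m' in
    rcons b ((a 0%N)^-1 *
      ((m' == 0)%N%:R - \sum_(1 <= k < m'.+1) a k * b`_(m' - k)%N))
  else [::].

Definition series_inv (a : nat -> R) : nat -> R :=
  fun m => (series_inv_prefix a m.+1)`_m.

Lemma size_series_inv_prefix a m : size (series_inv_prefix a m) = m.
Proof. by elim: m => //= m IHm; rewrite size_rcons IHm. Qed.

Lemma nth_series_inv_prefix a m i :
  (i < m)%N -> (series_inv_prefix a m)`_i = series_inv a i.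
Proof.
elim: m => // m IHm; rewrite ltnS leq_eqVlt => /orP[/eqP-> // | lt_im].
by rewrite /= nth_rcons size_series_inv_prefix lt_im IHm.
Qed.

Lemma series_mulV a :
  a 0%N \is a GRing.unit -> series_mul a (series_inv a) =1 series_one.
Proof.
move=> Ua m; rewrite /series_mul big_ord_recl /= subn0.
rewrite {1}/series_inv /= nth_rcons size_series_inv_prefix ltnn eqxx mulVKr //.
rewrite big_add1 /= big_mkord.
rewrite (eq_bigr (fun i : 'I_m => a i.+1 * series_inv a (m - i.+1))) ?subrK //.
move=> i _; rewrite nth_series_inv_prefix //.
by rewrite -subn_gt0 subKn.
Qed.

Lemma series_inv_unique a b : a 0%N \is a GRing.unit ->
  series_mul a b =1 series_one -> b =1 series_inv a.
Proof.
move=> Ua ab1 m; elim/ltn_ind: m => m IHm.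
apply: (mulrI Ua).
have := series_mulV Ua m; rewrite -ab1 /series_mul !big_ord_recl /= !subn0.
rewrite (eq_bigr (fun i : 'I_m => a (bump 0 i) * b (m - bump 0 i)%N)).
  by move/addIr.
move=> i _; rewrite IHm // /bump /= add1n -subn_gt0 subKn //.
Qed.

End PowerSeries.

(* The coefficient of x^m in the power series 1 / p(x). *)
Definition coef_inv (p : {poly int}) (m : nat) : int :=
  series_inv (series_of_poly p) m.

(* Ties x = k + 1/2 are rounded up. *)
Definition nearest_int (x : rat) : int := Num.floor (x + 2^-1).

Lemma nearest_intP (x : rat) : `|x - (nearest_int x)%:~R| <= 2^-1.
Proof.
have h1 := floor_le (x + 2^-1); have h2 := floorD1_gt (x + 2^-1).
rewrite /nearest_int; move: (Num.floor _) h1 h2 => f; rewrite intrD => h1 h2.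
by rewrite ler_norml; lra.
Qed.

Definition square_free (m : nat) : Prop :=
  forall d : nat, (d ^ 2 %| m)%N -> d = 1%N.

(* Main.v *)
Require Import Defs.
From HB Require Import structures.
From mathcomp Require Import all_boot all_order all_fingroup all_algebra.
From mathcomp Require Import cyclic.
From mathcomp Require Import zify lra.

Set Implicit Arguments.
Unset Strict Implicit.
Unset Printing Implicit Defensive.

Import Order.TTheory GRing.Theory Num.Theory.

Local Open Scope ring_scope.

(** Write m = 2e+1 and V = (Z/q)^n, so that q = m t and m^n divides q.

    Isomorphism types.  Lift the elements of a code C to the rows of an integer
    matrix.  Its Smith normal form gives an automorphism of V that maps C to a
    diagonal code, i.e. the product of the subgroups g_i Z/q for a chain of
    divisors g_1 | ... | g_n | q ([code_iso_diag]).  The chain is determined by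
    the class of C, since it can be read off from the cardinals of the groups
    k C ([diag_code_iso_inj]).

    Which chains occur.  A ball of radius e is a cube with m^n points, because
    m <= q; a perfect code has therefore index m^n, that is, the product of the
    g_i is m^n.  Conversely let g_1, ..., g_n have product m^n.  The diagonal
    code is the kernel of the diagonal matrix with entries q / g_i, whose
    determinant is t^n.  Over the integers this matrix is equivalent to a
    triangular one with all diagonal entries t or -t ([unimodular_trig]), and
    the kernel of such a matrix in V is a perfect code: if x is in the kernel
    and all its coordinates are at most 2e in absolute value, then the
    triangular system gives t x_i = 0, hence x_i = 0, for one coordinate after
    the other ([trig_ker_separated]).  So distinct codewords have disjoint
    balls, and by counting the balls cover V.  The hypothesis on m^(n-1) makes
    every chain with product m^n consist of divisors of q, so the number of
    classes is the number of these chains ([card_code_classes]).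

    Counting chains.  Dividing the entries of a chain with product N by the
    first one, c, and dropping that one leaves a chain of length n - 1 with
    product N / c^n ([divisor_chains]).  The resulting recursion for the number
    of chains is multiplicative in N, and for N = p^s it is the recursion for
    the partitions of s with parts of size at most n, whose generating series
    is 1 / ((1 - x) ... (1 - x^n)) ([coef_inv_partition_count]).  For n = 2 and
    n = 3 the recursion is solved explicitly. *)

(** * Chains of divisors with given product *)

(** The first entry c of a chain g_1 | ... | g_n divides all the others, and
    dividing those by c leaves a chain of length n - 1 with product N / c^n. *)
Fixpoint divisor_chains (n N : nat) : seq (seq nat) :=
  if n is n'.+1 then
    [seq c :: map (muln c) g | c <- [seq c <- divisors N | c ^ n %| N]%N,
                               g <- divisor_chains n' (N %/ c ^ n)%N]
  else if N == 1%N then [:: [::]] else [::].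

Lemma prod_map_muln c g :
  (\prod_(x <- map (muln c) g) x = c ^ size g * \prod_(x <- g) x)%N.
Proof.
rewrite big_map big_split /=; congr (_ * _)%N.
by elim: g => [|x g IHg]; rewrite ?big_nil // big_cons IHg expnS.
Qed.

Lemma divn_dvd_gt0 d N : (0 < N)%N -> (d %| N)%N -> (0 < N %/ d)%N.
Proof.
by move=> N_gt0 dN; rewrite divn_gt0 ?(dvdn_gt0 N_gt0 dN) // (dvdn_leq N_gt0 dN).
Qed.

Lemma mem_divisor_chains n N g : (0 < N)%N ->
  (g \in divisor_chains n N) =
    [&& size g == n, sorted dvdn g & (\prod_(x <- g) x)%N == N].
Proof.
elim: n N g => [|n IHn] N g N_gt0 /=.
  case: g => [|x g] /=; last by case: eqP.
  by rewrite big_nil eq_sym; case: eqP.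
have quot_gt0 c := @divn_dvd_gt0 (c ^ n.+1) N N_gt0.
apply/allpairsPdep/idP.
  move=> [c [h [/[!mem_filter]/andP[cN c_div]]]].
  rewrite IHn ?quot_gt0 // => /and3P[/eqP hn h_sorted /eqP hN] -> /=.
  have c_gt0 : (0 < c)%N by rewrite (dvdn_gt0 N_gt0) // dvdn_divisors.
  rewrite size_map hn eqxx big_cons prod_map_muln hn hN mulnA -expnS.
  rewrite mulnC divnK // eqxx /= andbT.
  rewrite (path_sortedE dvdn_trans); apply/andP; split.
    by apply/allP => _ /mapP[x _ ->]; rewrite dvdn_mulr.
  rewrite sorted_map; apply: sub_sorted h_sorted => x y /= xy.
  by rewrite dvdn_pmul2l.
case: g => // c g /and3P[/eqP[gn]] /=.
rewrite (path_sortedE dvdn_trans) => /andP[/allP c_all g_sorted].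
rewrite big_cons => /eqP defN.
have c_gt0 : (0 < c)%N by move: N_gt0; rewrite -defN muln_gt0 => /andP[].
pose h := map (fun x => x %/ c)%N g.
have def_g : g = map (muln c) h.
  rewrite -map_comp map_id_in // => x /c_all cx /=.
  by rewrite mulnC divnK.
have hn : size h = n by rewrite size_map.
have defN' : (N = c ^ n.+1 * \prod_(x <- h) x)%N.
  by rewrite -defN def_g prod_map_muln hn mulnA expnS.
have cN : (c ^ n.+1 %| N)%N by rewrite defN' dvdn_mulr.
exists c, h; split; last by rewrite -def_g.
  rewrite mem_filter cN -dvdn_divisors //.
  by rewrite (dvdn_trans _ cN) // expnS dvdn_mulr.
rewrite IHn ?quot_gt0 // hn eqxx defN' mulKn ?expn_gt0 ?c_gt0 // eqxx andbT.
move: g_sorted; rewrite def_g sorted_map; apply: sub_sorted => x y /=.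
by rewrite dvdn_pmul2l.
Qed.

Lemma divisor_chains_uniq n N : (0 < N)%N -> uniq (divisor_chains n N).
Proof.
elim: n N => [|n IHn] N N_gt0 /=; first by case: eqP.
apply: allpairs_uniq_dep => [|c|]; first exact/filter_uniq/divisors_uniq.
  by rewrite mem_filter => /andP[cN _]; exact/IHn/divn_dvd_gt0.
move=> [c g] [c' g'] /allpairsPdep[d [h [d_in h_in ->]]].
move=> /allpairsPdep[d' [h' [_ h'_in ->]]] /= [eq_d].
have d_gt0 : (0 < d)%N.
  by move: d_in; rewrite mem_filter -dvdn_divisors // => /andP[_ /(dvdn_gt0 N_gt0)].
rewrite -eq_d => eq_h; congr (Tagged _ _).
apply: inj_map eq_h => x y /eqP; rewrite eqn_pmul2l // => /eqP.
exact.
Qed.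

Lemma size_divisor_chainsS n N :
  size (divisor_chains n.+1 N) =
    (\sum_(c <- divisors N | c ^ n.+1 %| N)
        size (divisor_chains n (N %/ c ^ n.+1)))%N.
Proof. by rewrite size_allpairs_dep sumnE big_map big_filter. Qed.

Lemma perm_divisorsM a b : (0 < a)%N -> (0 < b)%N -> coprime a b ->
  perm_eq (divisors (a * b)) [seq (x * y)%N | x <- divisors a, y <- divisors b].
Proof.
move=> a_gt0 b_gt0 co_ab.
have co_xy x y : x \in divisors a -> y \in divisors b -> coprime x y.
  rewrite -!dvdn_divisors // => xa yb.
  exact: coprime_dvdl xa (coprime_dvdr yb co_ab).
apply: uniq_perm; first exact: divisors_uniq.
  apply: allpairs_uniq; rewrite ?divisors_uniq // => -[x y] [x' y'].
  move=> /allpairsP[[u v] [/= u_in v_in [-> ->]]].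
  move=> /allpairsP[[u' v'] [/= u'_in v'_in [-> ->]]] eq_uv.
  have eq_u : u = u'.
    apply/eqP; rewrite eqn_dvd.
    rewrite -(Gauss_dvdl u' (co_xy u v' u_in v'_in)) -eq_uv dvdn_mulr //=.
    by rewrite -(Gauss_dvdl u (co_xy u' v u'_in v_in)) eq_uv dvdn_mulr.
  congr (_, _) => //; move: eq_uv; rewrite -eq_u => /eqP.
  rewrite eqn_pmul2l => [/eqP //|]; move: u_in; rewrite -dvdn_divisors //.
  exact: dvdn_gt0.
move=> d; rewrite -dvdn_divisors ?muln_gt0 ?a_gt0 //.
apply/idP/allpairsP => [d_ab|[[x y] [/= x_in y_in ->]]]; last first.
  by rewrite dvdn_mul // dvdn_divisors.
exists (gcdn d a, gcdn d b); rewrite /= -!dvdn_divisors // !dvdn_gcdr.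
split=> //; apply/eqP; rewrite eqn_dvd; apply/andP; split.
  rewrite muln_gcdl !muln_gcdr !dvdn_gcd.
  by rewrite dvdn_mulr // dvdn_mulr // dvdn_mull.
rewrite Gauss_dvd ?dvdn_gcdl //.
by apply: co_xy; rewrite -dvdn_divisors // dvdn_gcdr.
Qed.

Lemma perm_divisorsX p s : prime p ->
  perm_eq (divisors (p ^ s)) [seq (p ^ i)%N | i <- iota 0 s.+1].
Proof.
move=> p_pr; apply: uniq_perm; first exact: divisors_uniq.
  rewrite map_inj_uniq ?iota_uniq // => i j /eqP.
  by rewrite eqn_exp2l ?prime_gt1 // => /eqP.
move=> d; rewrite -dvdn_divisors ?expn_gt0 ?prime_gt0 //.
apply/(dvdn_pfactor _ _ p_pr)/mapP => [] [i].
  by move=> i_le ->; exists i; rewrite // mem_iota.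
by rewrite mem_iota => /andP[_ i_lt] ->; exists i.
Qed.

(** A divisor c of a b splits uniquely into divisors of a and b, and the
    condition c^n | a b splits accordingly, so both sides satisfy the same
    recursion. *)
Lemma size_divisor_chainsM n a b : (0 < a)%N -> (0 < b)%N -> coprime a b ->
  size (divisor_chains n (a * b)) =
    (size (divisor_chains n a) * size (divisor_chains n b))%N.
Proof.
elim: n a b => [|n IHn] a b a_gt0 b_gt0 co_ab.
  by rewrite /= muln_eq1; case: eqP => //; case: eqP.
rewrite !size_divisor_chainsS big_mkcond (perm_big _ (perm_divisorsM _ _ _)) //=.
rewrite big_allpairs_dep.
rewrite [X in _ = (X * _)%N]big_mkcond [X in _ = (_ * X)%N]big_mkcond.
rewrite big_distrl /=.
apply: eq_big_seq => x; rewrite -dvdn_divisors // => xa.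
rewrite big_distrr /=; apply: eq_big_seq => y; rewrite -dvdn_divisors // => yb.
have co_xb k : coprime (x ^ k) b by rewrite coprimeXl // (coprime_dvdl xa).
have co_ya k : coprime (y ^ k) a.
  by rewrite coprimeXl // coprime_sym (coprime_dvdr yb).
rewrite expnMn Gauss_dvd; last first.
  by apply/coprimeXr/(coprime_dvdr yb)/co_xb.
rewrite Gauss_dvdl ?co_xb // Gauss_dvdr ?co_ya //.
case: ifP => [/andP[xna ynb]|]; last first.
  by move/negbT; rewrite negb_and => /orP[]/negPf->; rewrite ?muln0.
rewrite xna ynb -(IHn _ _ (divn_dvd_gt0 a_gt0 xna) (divn_dvd_gt0 b_gt0 ynb)).
  by rewrite divnMA -divn_mulAC // -muln_divA.
exact: coprime_dvdl (dvdn_div xna) (coprime_dvdr (dvdn_div ynb) co_ab).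
Qed.

(** * Partitions with bounded parts *)

(** Counts partitions of s with parts at most n by the multiplicity i of the
    part n. *)
Fixpoint partition_count (n s : nat) : nat :=
  if n is n'.+1 then
    (\sum_(i < s.+1 | n * i <= s) partition_count n' (s - n * i))%N
  else (s == 0%N).

Lemma size_divisor_chainsX n p s : prime p ->
  size (divisor_chains n (p ^ s)) = partition_count n s.
Proof.
move=> p_pr; elim: n s => [|n IHn] s.
  by rewrite /= -[X in _ == X](expn0 p) eqn_exp2l ?prime_gt1 //; case: eqP.
rewrite size_divisor_chainsS (perm_big _ (perm_divisorsX _ p_pr)) big_map.
rewrite -[iota 0 s.+1]/(index_iota 0 s.+1) big_mkord.
have dvdX i : ((p ^ i) ^ n.+1 %| p ^ s)%N = (n.+1 * i <= s)%N.
  by rewrite -expnM mulnC dvdn_Pexp2l ?prime_gt1.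
apply: eq_big => i; rewrite dvdX // => le_is.
by rewrite -expnM mulnC -expnB ?prime_gt0 // IHn.
Qed.

Lemma multiplicative_primes (G : nat -> nat) : G 1%N = 1%N ->
  (forall a b, (0 < a)%N -> (0 < b)%N -> coprime a b ->
     G (a * b)%N = (G a * G b)%N) ->
  forall N, (0 < N)%N -> G N = (\prod_(p <- primes N) G (p ^ logn p N))%N.
Proof.
move=> G1 GM N N_gt0.
rewrite [in LHS](prod_prime_decomp N_gt0) prime_decompE big_map /=.
have: {in primes N, forall p, prime p}.
  by move=> p; rewrite mem_primes => /andP[].
elim: (primes N) (primes_uniq N) => [|p s IHs] /=; first by rewrite !big_nil.
move=> /andP[p_notin s_uniq] pr_s; rewrite !big_cons.
have p_pr : prime p by rewrite pr_s ?mem_head.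
have pr_s' : {in s, forall r, prime r}.
  by move=> r r_in; rewrite pr_s // in_cons r_in orbT.
rewrite GM ?IHs ?expn_gt0 ?(prime_gt0 p_pr) //.
  by rewrite big_seq prodn_cond_gt0 // => r /pr_s'/prime_gt0; rewrite expn_gt0 => ->.
rewrite big_seq; elim/big_ind: _ => [|x y cx cy|r r_in].
- exact: coprimen1.
- by rewrite coprimeMr cx cy.
rewrite coprimeXl // coprimeXr // prime_coprime // (dvdn_prime2 p_pr (pr_s' r r_in)).
by apply: contraNneq p_notin => ->.
Qed.

Lemma size_divisor_chainsE n N : (0 < N)%N ->
  size (divisor_chains n N) =
    (\prod_(p <- primes N) partition_count n (logn p N))%N.
Proof.
move=> N_gt0; rewrite (multiplicative_primes _ (@size_divisor_chainsM n)) //.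
  apply: eq_big_seq => p; rewrite mem_primes => /andP[p_pr _].
  exact: size_divisor_chainsX.
elim: n => // n IHn; rewrite size_divisor_chainsS (_ : divisors 1 = [:: 1]%N) //.
by rewrite big_cons big_nil exp1n dvd1n divn1 IHn.
Qed.

Lemma size_divisorsE N : (0 < N)%N ->
  size (divisors N) = (\prod_(p <- primes N) (logn p N).+1)%N.
Proof.
move=> N_gt0; pose G d := size (divisors d).
rewrite -/(G N) (multiplicative_primes (G := G)) //.
  apply: eq_big_seq => p; rewrite mem_primes => /andP[p_pr _].
  by rewrite /G (perm_size (perm_divisorsX _ p_pr)) size_map size_iota.
move=> a b a_gt0 b_gt0 co_ab.
by rewrite /G (perm_size (perm_divisorsM _ _ co_ab)) // size_allpairs.
Qed.

(** Either the part n + 1 does not occur, or one copy of it is removed.  For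
    the generating series P_n this says (1 - x^(n+1)) P_(n+1) = P_n. *)
Lemma partition_countS n s : partition_count n.+1 s =
  (partition_count n s +
   (if n.+1 <= s then partition_count n.+1 (s - n.+1) else 0))%N.
Proof.
rewrite /= big_mkcond big_ord_recl /= muln0 subn0; congr (_ + _)%N.
case: (leqP n.+1 s) => [lt_ns|lt_sn]; last first.
  rewrite big1 // => i _; rewrite leqNgt (leq_trans lt_sn) //.
  by rewrite /bump /= add1n mulnS leq_addr.
rewrite [RHS]big_mkcond /=.
rewrite (big_ord_widen_cond s (fun=> true)
  (fun i => if n.+1 * i <= s - n.+1 then partition_count n (s - n.+1 - n.+1 * i)
            else 0)%N) /=; last by rewrite subnSK // leq_subr.
rewrite [RHS]big_mkcond /=; apply: eq_bigr => i _.
rewrite /bump /= add1n mulnS -subnDA -leq_subRL //.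
have [le_i|] := boolP (n.+1 * i <= s - n.+1)%N; last by case: ifP.
by rewrite ltnS (leq_trans _ le_i) // leq_pmull.
Qed.

Arguments partition_count : simpl never.

(** The series of partition counts is shown to be an inverse of the product of
    the 1 - x^k.  Coefficients up to degree m only see the truncation of a
    series at degree m, so associativity can be taken from polynomials. *)
Lemma coef_inv_partition_count n m :
  coef_inv (\prod_(1 <= k < n.+1) (1 - 'X^k)) m = (partition_count n m)%:Z.
Proof.
set p := fun n => \prod_(1 <= k < n.+1) (1 - 'X^k) : {poly int}.
have mulpE (P : {poly int}) (b : nat -> int) N j : (j <= N)%N ->
    series_mul (series_of_poly P) b j = (P * \poly_(i < N.+1) b i)`_j.
  move=> le_jN; rewrite coefM; apply: eq_bigr => i _.
  by rewrite coef_poly ltnS (leq_trans (leq_subr _ _)).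
have mul1 : series_mul (series_of_poly (p n)) (fun m => (partition_count n m)%:Z)
              =1 @series_one int.
  elim: n {m} => [|n IHn] m.
    rewrite (mulpE _ _ m) // /p big_nil mul1r coef_poly ltnSn.
    by rewrite /series_one /partition_count; case: eqP.
  rewrite -IHn !(mulpE _ _ m) // /p big_nat_recr //= -/(p n) -mulrA !coefM.
  apply: eq_bigr => i _; congr (_ * _); set s := (m - i)%N.
  have le_sm : (s < m.+1)%N by rewrite ltnS leq_subr.
  rewrite mulrBl mul1r coefB mulrC coefMXn !coef_poly le_sm partition_countS.
  case: (leqP n.+1 s) => [le_ns|lt_sn].
    by rewrite (leq_ltn_trans (leq_subr _ _)) // PoszD addrK.
  by rewrite subr0 addn0.
rewrite /coef_inv -(series_inv_unique _ mul1) //.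
apply/unitrPr; exists (partition_count n 0)%:Z.
by have := mul1 0%N; rewrite /series_mul big_ord_recl big_ord0 addr0.
Qed.

(** * Triangular forms with constant diagonal *)

Lemma sorted_dvdz_nth (d : seq int) i j :
  sorted dvdz d -> (i <= j)%N -> (d`_i %| d`_j)%Z.
Proof.
move=> d_sorted le_ij; have [lt_j|ge_j] := ltnP j (size d).
  by apply: (sorted_leq_nth dvdz_trans dvdzz) => //; apply: leq_ltn_trans le_ij _.
by rewrite (nth_default _ ge_j) dvdz0.
Qed.

(** Move the coordinate 1 to the front and put the row on top of an
    identity matrix. *)
Lemma complete_row (R : comUnitRingType) k (w : 'rV[R]_k.+1) j :
  w 0 j = 1 -> exists2 M : 'M[R]_k.+1, M \in unitmx & row 0 M = w.
Proof.
move=> wj; pose v := xcol 0 j w : 'rV_(1 + k).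
pose M : 'M[R]_(1 + k) := block_mx 1%:M (rsubmx v) 0 1%:M.
have M_unit : M \in unitmx by rewrite unitmxE det_ublock !det1 mulr1 unitr1.
have row_M : @row R (1 + k) (1 + k) 0 M = v.
  have -> : (0 : 'I_(1 + k)) = lshift k 0 by apply: val_inj.
  rewrite -[RHS]hsubmxK /M /block_mx rowKu row_row_mx !row_id.
  congr row_mx; apply/rowP => i; rewrite !ord1 !mxE /=.
  have -> : lshift k (0 : 'I_1) = 0 :> 'I_k.+1 by apply: val_inj.
  by rewrite tpermL wj.
exists (xcol 0 j M).
  by rewrite xcolE unitmx_mul M_unit unitmx_perm.
by rewrite xcolE row_mul row_M /v xcolE -mulmxA -perm_mxM tperm2 perm_mx1 mulmx1.
Qed.

(** In the Smith form d_0 | ... | d_k of A the hypothesis on the determinant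
    forces d_0 | t | d_k.  With t = a d_0 and d_k = b t, the row
    u = (a, 0, ..., 0, 1) is mapped by the Smith form to t w with
    w = (1, 0, ..., 0, b).  Both u and w have a coordinate 1, so they are first
    rows of invertible matrices, and in the corresponding bases the first row
    becomes (t, 0, ..., 0).  The remaining block has determinant t^k up to
    sign, which allows an induction. *)
Lemma unimodular_trig (t : nat) n (A : 'M[int]_n) :
  (0 < t)%N -> `|\det A|%N = (t ^ n)%N ->
  exists P Q : 'M[int]_n,
    [/\ P \in unitmx, Q \in unitmx, is_trig_mx (P *m A *m Q)
      & forall i, `|(P *m A *m Q) i i|%N = t].
Proof.
move=> t_gt0; elim: n A => [|[|k] IHk] A detA.
- by exists 1%:M, 1%:M; rewrite unitmx1; split=> //; [apply/is_trig_mxP|]; case.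
- exists 1%:M, 1%:M; rewrite unitmx1 mul1mx mulmx1; split=> //.
    by apply/is_trig_mxP => i j; rewrite !ord1.
  by move=> i; rewrite ord1 -det_mx11 detA expn1.
have abs_unit m (M : 'M[int]_m) : M \in unitmx -> `|\det M|%N = 1%N.
  rewrite unitmxE => /unitrPr[y /(congr1 absz)/eqP].
  by rewrite abszM muln_eq1 => /andP[/eqP].
have [L L_unit [R R_unit [d d_sorted defA]]] := int_Smith_normal_form A.
set D := (\matrix_(i, j) _) in defA.
have D_diag : D = diag_mx (\row_(i < k.+2) d`_i).
  by apply/matrixP => i j; rewrite !mxE.
have prod_d : (\prod_(i < k.+2) `|(d`_i)%R| = t ^ k.+2)%N.
  rewrite -detA defA !det_mulmx !abszM (abs_unit _ _ L_unit) (abs_unit _ _ R_unit).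
  rewrite mul1n muln1 D_diag det_diag (big_morph absz abszM (erefl _)).
  by apply: eq_bigr => i _; rewrite mxE.
have dvd_prod (F G : 'I_k.+2 -> nat) : (forall i, F i %| G i)%N ->
    (\prod_i F i %| \prod_i G i)%N.
  by move=> FG; elim/big_ind2: _ => // ? ? ? ? ? ?; apply: dvdn_mul.
have powE c : (c ^ k.+2 = \prod_(i < k.+2) c)%N by rewrite prod_nat_const card_ord.
have d0_t : (`|(d`_0)%R| %| t)%N.
  rewrite -(@dvdn_pexp2r _ _ k.+2) // -prod_d powE.
  by apply: dvd_prod => i; apply: sorted_dvdz_nth.
have t_dk : (t %| `|(d`_k.+1)%R|)%N.
  rewrite -(@dvdn_pexp2r _ _ k.+2) // -prod_d powE.
  by apply: dvd_prod => i; apply: sorted_dvdz_nth; rewrite // -ltnS.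
have /dvdzP[a def_t] : (d`_0 %| t%:Z)%Z by [].
have /dvdzP[b def_dk] : (t%:Z %| d`_k.+1)%Z by [].
pose u : 'rV[int]_k.+2 := \row_i (a *+ (i == 0) + (i == ord_max)%:R).
pose w : 'rV[int]_k.+2 := \row_i ((i == 0)%:R + b *+ (i == ord_max)).
have uD : u *m D = t%:Z *: w.
  apply/rowP => i; rewrite D_diag mul_mx_diag !mxE mulrDl mulrDr.
  case: eqP => [->|_] /=; first by rewrite def_t !mulr0n mul0r mulr0 !addr0 mulr1.
  rewrite mul0r mulr0 !add0r; case: eqP => [->|_] /=; last by rewrite mul0r mulr0.
  by rewrite def_dk mul1r mulr1n mulrC.
have u_max : u 0 ord_max = 1 by rewrite !mxE eqxx mulr0n add0r.
have w_0 : w 0 0 = 1 by rewrite !mxE eqxx mulr0n addr0.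
have [Lu Lu_unit row_Lu] := complete_row u_max.
have [Rw Rw_unit row_Rw] := complete_row w_0.
pose P0 := Lu *m invmx L; pose Q0 := invmx R *m invmx Rw.
have P0_unit : P0 \in unitmx by rewrite unitmx_mul Lu_unit unitmx_inv.
have Q0_unit : Q0 \in unitmx by rewrite unitmx_mul !unitmx_inv R_unit.
have [B defB] : {B | B = P0 *m A *m Q0} by exists (P0 *m A *m Q0).
have row_B : row 0 B = t%:Z *: row 0 1%:M.
  have -> : B = Lu *m D *m invmx Rw.
    by rewrite defB defA !mulmxA mulmxKV // mulmxK.
  rewrite !row_mul row_Lu uD -scalemxAl -row_Rw -row_mul mulmxV //.
pose B1 : 'M_(1 + k.+1) := B.
have defB1 : B1 = block_mx (t%:Z)%:M 0 (dlsubmx B1) (drsubmx B1).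
  rewrite -[LHS]submxK; congr block_mx; apply/matrixP => i j.
    have /rowP/(_ 0) := row_B; rewrite !ord1 !mxE /= mulr1 mulr1n => <-.
    by congr (B _ _); apply: val_inj.
  have /rowP/(_ (rshift 1 j)) := row_B; rewrite !ord1 !mxE /= mulr0 => <-.
  by congr (B _ _); apply: val_inj.
have detB1 : `|\det (drsubmx B1)|%N = (t ^ k.+1)%N.
  apply/eqP; rewrite -(eqn_pmul2l t_gt0) -expnS -detA; apply/eqP.
  have -> : `|\det A|%N = `|\det B1|%N.
    rewrite /B1 defB 2!det_mulmx 2!abszM.
    by rewrite (abs_unit _ _ P0_unit) (abs_unit _ _ Q0_unit) mul1n muln1.
  by rewrite [in RHS]defB1 det_lblock det_scalar1 abszM.
have [P [Q [P_unit Q_unit PQ_trig PQ_diag]]] := IHk _ detB1.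
pose P1 : 'M_(1 + k.+1) := block_mx 1%:M 0 0 P.
pose Q1 : 'M_(1 + k.+1) := block_mx 1%:M 0 0 Q.
have P1_unit : P1 \in unitmx by rewrite unitmxE det_ublock det1 mul1r -unitmxE.
have Q1_unit : Q1 \in unitmx by rewrite unitmxE det_ublock det1 mul1r -unitmxE.
have prodE : P1 *m B1 *m Q1 =
    block_mx (t%:Z)%:M 0 (P *m dlsubmx B1) (P *m drsubmx B1 *m Q).
  rewrite {1}defB1 /P1 /Q1 !mulmx_block.
  by rewrite !mul1mx !mul0mx !mulmx0 !mulmx1 !addr0 !add0r mul0mx.
exists (P1 *m P0), (Q0 *m Q1).
have -> : P1 *m P0 *m A *m (Q0 *m Q1) = P1 *m B1 *m Q1 by rewrite /B1 defB !mulmxA.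
split; [by rewrite unitmx_mul P1_unit | by rewrite unitmx_mul Q1_unit andbT | |].
  suff : @is_trig_mx _ (1 + k.+1) (1 + k.+1) (P1 *m B1 *m Q1) by [].
  by rewrite prodE is_trig_block_mx // eqxx scalar_mx_is_trig PQ_trig.
suff : forall i,
    `|@fun_of_matrix _ (1 + k.+1) (1 + k.+1) (P1 *m B1 *m Q1) i i|%N = t by [].
move=> i; rewrite prodE; case: (split_ordP i) => j ->.
  by rewrite block_mxEul !ord1 mxE mulr1n.
by rewrite block_mxEdr PQ_diag.
Qed.

(** * Diagonal codes and their invariants *)

Lemma natZq_eq0 q k : (1 < q)%N -> (k%:R == 0 :> 'Z_q) = (q %| k)%N.
Proof.
by move=> q_gt1; rewrite -val_eqE /= val_Zp_nat // /dvdn.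
Qed.

Lemma intZq_eq0 q (z : int) : (1 < q)%N ->
  (z%:~R == 0 :> 'Z_q) = (q %| `|z|)%N.
Proof.
move=> q_gt1; case: (intP z) => [|k|k]; first by rewrite eqxx dvdn0.
  by rewrite -[_%:~R]/(k.+1%:R) natZq_eq0.
by rewrite mulrNz oppr_eq0 -[_%:~R]/(k.+1%:R) natZq_eq0 // abszN.
Qed.

Definition multiples (q a : nat) : {set 'Z_q} := [set z * a%:R | z : 'Z_q].

Lemma multiplesP q a (x : 'Z_q) :
  reflect (exists z : 'Z_q, x = z * a%:R) (x \in multiples q a).
Proof.
by apply: (iffP imsetP) => [[z _ ->] | [z ->]]; exists z.
Qed.

Lemma multiples_gcd q a : (1 < q)%N -> multiples q (gcdn q a) = multiples q a.
Proof.
move=> q_gt1; have q0 : q%:R = 0 :> 'Z_q by apply/eqP; rewrite natZq_eq0.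
apply/setP => x; apply/multiplesP/multiplesP => [] [z ->]; last first.
  have /dvdnP[b {1}->] := dvdn_gcdr q a.
  by exists (z * b%:R); rewrite natrM mulrA.
have q_gt0 : (0 < q)%N by apply: ltnW.
have [a0|a_gt0] := posnP a.
  by exists 0; rewrite a0 gcdn0 q0 mulr0 mul0r.
(* Bezout: gcd (q, a) is u a modulo q. *)
have [u v /(congr1 (fun k => k%:R : 'Z_q)) uv _] := egcdnP q a_gt0.
exists (z * u%:R); rewrite -mulrA -natrM uv natrD natrM q0 mulr0 add0r.
by rewrite gcdnC.
Qed.

Lemma card_multiples q a : (1 < q)%N -> (#|multiples q a| * gcdn q a = q)%N.
Proof.
move=> q_gt1.
have -> : multiples q a = <[(a%:R : 'Z_q)]>%g.
  apply/setP => x; apply/multiplesP/cycleP => [[z ->]|[k ->]].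
    by exists z; rewrite FinRing.zmodXgE -[RHS]mulr_natl natr_Zp.
  by exists k%:R; rewrite FinRing.zmodXgE mulr_natl.
rewrite -[#|_|]/(#[(a%:R : 'Z_q)]%g).
have -> : (a%:R : 'Z_q) = (Zp1 ^+ a)%g :> 'Z_q by rewrite FinRing.zmodXgE.
by rewrite orderXgcd order_Zp1 Zp_cast // divnK ?dvdn_gcdl.
Qed.

Definition diag_code_set (q n : nat) (a : 'I_n -> nat) : {set 'rV['Z_q]_n} :=
  [set x : 'rV['Z_q]_n | [forall i, x 0 i \in multiples q (a i)]].

Lemma diag_codeP q n (a : 'I_n -> nat) (x : 'rV['Z_q]_n) :
  reflect (exists z : 'I_n -> 'Z_q, forall i, x 0 i = z i * (a i)%:R)
          (x \in diag_code_set q a).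
Proof.
rewrite inE; apply: (iffP forallP) => [x_in | [z x_z] i].
  have z_ex i : exists z : 'Z_q, x 0 i = z * (a i)%:R by apply/multiplesP/x_in.
  by have [z x_z] := fin_all_exists z_ex; exists z.
by apply/multiplesP; exists (z i).
Qed.

Lemma diag_code_group_set q n (a : 'I_n -> nat) : group_set (diag_code_set q a).
Proof.
apply/group_setP; split=> [|x y].
  by apply/diag_codeP; exists (fun=> 0) => i; rewrite mul0r mxE.
move=> /diag_codeP[u xu] /diag_codeP[v yv]; apply/diag_codeP.
by exists (fun i => u i + v i) => i; rewrite FinRing.zmodMgE mxE xu yv mulrDl.
Qed.

Definition diag_code q n (a : 'I_n -> nat) : {group 'rV['Z_q]_n} :=
  Group (diag_code_group_set q a).

Lemma code_iso_mulmx q n (R : 'M['Z_q]_n) (C1 C2 : {group 'rV['Z_q]_n}) :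
  R \in unitmx -> C1 = [set x *m R | x in C2] :> {set _} -> code_iso C1 C2.
Proof.
move=> R_unit defC1.
have R_inj : injective (fun x : 'rV['Z_q]_n => x *m R).
  exact: can_inj (fun x => mulmxK R_unit x).
apply/existsP; exists (perm R_inj); apply/andP; split.
  rewrite inE; apply/andP; split; first by apply/subsetP => x _; rewrite inE.
  by apply/morphicP => x y _ _; rewrite !permE FinRing.zmodMgE mulmxDl.
by apply/eqP; rewrite defC1; apply: eq_imset => x; rewrite permE.
Qed.

Lemma code_iso_card_mulrn q n (C1 C2 : {group 'rV['Z_q]_n}) k :
  code_iso C1 C2 -> #|[set x *+ k | x in C1]| = #|[set x *+ k | x in C2]|.
Proof.
move=> /existsP[f /andP[fA /eqP defC1]].
have fD : {morph f : x y / x + y}.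
  move: fA; rewrite inE => /andP[_ /morphicP fM] x y.
  by rewrite -FinRing.zmodMgE fM ?inE.
have f0 : f 0 = 0 by apply: (addrI (f 0)); rewrite -fD !addr0.
have fX : {morph f : x / x *+ k}.
  by move=> x; elim: k => [|k IHk]; rewrite ?mulr0n // !mulrS fD IHk.
rewrite defC1 -imset_comp (eq_imset (g := f \o (fun x => x *+ k))) => [|x /=].
  by rewrite imset_comp card_imset //; apply: perm_inj.
by rewrite fX.
Qed.

Lemma card_row_set (T : finType) n (F : 'I_n -> {set T}) :
  #|[set x : 'rV[T]_n | [forall i, x 0 i \in F i]]| = (\prod_i #|F i|)%N.
Proof.
pose row_of (f : {ffun 'I_n -> T}) : 'rV[T]_n := \row_i f i.
have row_inj : injective row_of.
  by move=> f h /rowP fh; apply/ffunP => i; have := fh i; rewrite !mxE.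
have -> : [set x : 'rV[T]_n | [forall i, x 0 i \in F i]] =
    row_of @: [set f | f \in family (fun i => mem (F i))].
  apply/setP => x; apply/idP/imsetP => [|[f]]; rewrite ?inE.
    move=> /forallP x_in; exists [ffun i => x 0 i]; last first.
      by apply/rowP => i; rewrite mxE ffunE.
    by rewrite inE; apply/familyP => i; rewrite ffunE; apply: x_in.
  move=> /familyP f_in ->; apply/forallP => i; rewrite mxE; exact: f_in.
by rewrite card_imset // cardsE card_family foldrE big_map big_enum.
Qed.

(** Each factor a Z/q has q / gcd (q, a) elements; the product form avoids the
    division. *)
Lemma card_diag_code q n (a : 'I_n -> nat) : (1 < q)%N ->
  (#|diag_code_set q a| * \prod_i gcdn q (a i) = q ^ n)%N.
Proof.
move=> q_gt1; have -> : #|diag_code_set q a| = (\prod_i #|multiples q (a i)|)%N.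
  exact: card_row_set.
rewrite -big_split /= (eq_bigr (fun=> q)) => [|i _]; last exact: card_multiples.
by rewrite prod_nat_const card_ord.
Qed.

(** The cardinal of k C for a diagonal code C; these cardinals are the
    invariants that separate the classes. *)
Lemma card_diag_code_mulrn q n (a : 'I_n -> nat) k : (1 < q)%N ->
  (#|[set x *+ k | x in diag_code_set q a]| * \prod_i gcdn q (k * a i) = q ^ n)%N.
Proof.
move=> q_gt1; rewrite -(card_diag_code (fun i => k * a i)%N q_gt1).
congr (#|pred_of_set _| * _)%N.
apply/setP => x; apply/imsetP/diag_codeP => [[y /diag_codeP[z yz] ->]|[z xz]].
  by exists z => i; rewrite -scaler_nat mxE yz natrM mulrCA.
exists (\row_i (z i * (a i)%:R)).
  by apply/diag_codeP; exists z => i; rewrite mxE.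
apply/rowP => i; rewrite -scaler_nat !mxE xz natrM.
by rewrite mulrCA.
Qed.

(** The first entry c of a chain is recovered from the profile
    k |-> prod_i gcd (q, k g_i): at k = q / c all factors reach their maximum q,
    hence so do those of the other chain, and its first entry is a multiple of
    c.  By symmetry the first entries agree, and they cancel. *)
Lemma sorted_gcd_profile_inj q (g h : seq nat) : (0 < q)%N ->
  size g = size h -> sorted dvdn g -> sorted dvdn h ->
  all (dvdn^~ q) g -> all (dvdn^~ q) h ->
  (forall k, \prod_(x <- g) gcdn q (k * x) = \prod_(x <- h) gcdn q (k * x))%N ->
  g = h.
Proof.
move=> q_gt0; elim: g h => [|a g IHg] [|b h] //= [eq_size].
rewrite !(path_sortedE dvdn_trans).
move=> /andP[ag g_sorted] /andP[bh h_sorted] /andP[aq gq] /andP[bq hq] eq_prof.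
have head_dvd c s d r : size s = size r -> all (dvdn c) s -> (c %| q)%N ->
    (\prod_(x <- c :: s) gcdn q (q %/ c * x)
       = \prod_(x <- d :: r) gcdn q (q %/ c * x))%N -> (c %| d)%N.
  move=> eq_sr cs cq eq_c; have c_gt0 := dvdn_gt0 q_gt0 cq.
  have le_q k : (gcdn q k <= q)%N by rewrite dvdn_leq ?dvdn_gcdl.
  have all_q : (\prod_(x <- c :: s) gcdn q (q %/ c * x) = q ^ (size r).+1)%N.
    rewrite -eq_sr big_cons divnK // gcdnn expnS; congr (_ * _)%N.
    elim: s cs {eq_sr eq_c} => [|x s IHs] /=; first by rewrite big_nil.
    move=> /andP[/dvdnP[y ->] cs]; rewrite big_cons IHs // expnS; congr (_ * _)%N.
    by apply/gcdn_idPl; rewrite mulnCA divnK // dvdn_mull.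
  have tail_le : (\prod_(x <- r) gcdn q (q %/ c * x) <= q ^ size r)%N.
    elim: r {eq_sr eq_c all_q} => [|x r IHr]; first by rewrite big_nil.
    by rewrite big_cons expnS leq_mul.
  have : (q <= gcdn q (q %/ c * d))%N.
    rewrite -(leq_pmul2r (_ : 0 < q ^ size r)%N) ?expn_gt0 ?q_gt0 //.
    by rewrite -expnS -all_q eq_c big_cons leq_mul2l tail_le orbT.
  rewrite leqNgt ltn_neqAle le_q andbT negbK => /eqP/gcdn_idPl.
  by rewrite -{1}(divnK cq) dvdn_pmul2l // divn_dvd_gt0.
have eq_ab : a = b.
  apply/eqP; rewrite eqn_dvd (head_dvd a g b h) //.
  by rewrite (head_dvd b h a g) // eq_prof.
rewrite eq_ab; congr (_ :: _); apply: IHg => // k.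
have := eq_prof k; rewrite !big_cons eq_ab => /eqP.
by rewrite eqn_pmul2l ?gcdn_gt0 ?q_gt0 // => /eqP.
Qed.

Lemma map_intr_unitmx (R : comUnitRingType) n (M : 'M[int]_n) :
  M \in unitmx -> map_mx (intr : int -> R) M \in unitmx.
Proof. by rewrite !unitmxE det_map_mx; apply: rmorph_unit. Qed.

(** * Every code is equivalent to a diagonal code *)

Lemma multiples_intP q (d : int) (x : 'Z_q) :
  reflect (exists z : 'Z_q, x = z * d%:~R) (x \in multiples q `|d|).
Proof.
apply: (iffP (multiplesP _ _)) => [] [z ->]; case: d => k.
- by exists z.
- by exists (- z); rewrite NegzE mulrNz mulrNN.
- by exists z.
- by exists (- z); rewrite NegzE mulrNz mulrN mulNr.
Qed.

(** The code is the row span over Z/q of the integer matrix of its elements.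
    If that matrix is L D R with D in Smith form, then L does not change the
    span and R is an automorphism of (Z/q)^n, so the code is the image of the
    span of D. *)
Lemma code_iso_diag q n (C : {group 'rV['Z_q]_n}) : (1 < q)%N ->
  exists g : seq nat, [/\ size g = n, sorted dvdn g, all (dvdn^~ q) g
    & code_iso (diag_code q (fun i : 'I_n => nth 0%N g i)) C].
Proof.
move=> q_gt1; pose N := #|C|.
pose M : 'M[int]_(N, n) :=
  \matrix_(i, j) (nat_of_ord ((enum_val i : 'rV['Z_q]_n) 0 j))%:Z.
pose red m1 m2 (A : 'M[int]_(m1, m2)) := map_mx (intr : int -> 'Z_q) A.
have row_M i : row i (red _ _ M) = enum_val i.
  by apply/rowP => j; rewrite !mxE -[RHS]natr_Zp.
have defC : C = [set z *m red _ _ M | z : 'rV_N] :> {set _}.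
  apply/setP => x; apply/idP/imsetP => [xC|[z _ ->]].
    exists (delta_mx 0 (enum_rank_in xC x)) => //.
    by rewrite -rowE row_M enum_rankK_in.
  rewrite mulmx_sum_row; elim/big_ind: _ => [|u v uC vC|i _].
  - exact: (group1 C).
  - exact: (groupM uC vC).
  rewrite row_M -[z 0 i]natr_Zp scaler_nat; exact: (groupX _ (enum_valP i)).
have [L L_unit [R R_unit [d d_sorted defM]]] := int_Smith_normal_form M.
set D := (\matrix_(i, j) _) in defM.
have redM : red _ _ M = red _ _ L *m red _ _ D *m red _ _ R.
  by rewrite defM /red !map_mxM.
have uL : red _ _ L \in unitmx by apply: map_intr_unitmx.
have uR : red _ _ R \in unitmx by apply: map_intr_unitmx.
(* The columns j >= N of D vanish; this is encoded by gcd (q, 0) = q. *)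
pose a (j : nat) := if (j < N)%N then `|(d`_j)%R|%N else 0%N.
have dvd_a i j : (i <= j)%N -> (a i %| a j)%N.
  rewrite /a => le_ij; case: (ltnP j N) => [lt_j|_]; last exact: dvdn0.
  by rewrite (leq_ltn_trans le_ij lt_j); apply: sorted_dvdz_nth.
exists (mkseq (fun j => gcdn q (a j)) n); split.
- by rewrite size_mkseq.
- apply/(sortedP 0%N) => i; rewrite size_mkseq => lt_i.
  rewrite !nth_mkseq ?(ltnW lt_i) // dvdn_gcd dvdn_gcdl.
  by rewrite (dvdn_trans (dvdn_gcdr _ _)) // dvd_a.
- by apply/allP => _ /mapP[j _ ->]; rewrite dvdn_gcdl.
apply: (code_iso_mulmx (R := invmx (red _ _ R))); first by rewrite unitmx_inv.
have redDE (y : 'rV_N) (j : 'I_n) : (y *m red _ _ D) 0 j =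
    if insub (nat_of_ord j) is Some i then y 0 i * (d`_j)%:~R else 0.
  rewrite mxE; case: insubP => [i _ def_i | ge_j].
    rewrite (bigD1 i) //= !mxE def_i eqxx big1 ?addr0 // => k ne_ki.
    rewrite !mxE; case: eqP => [eq_kj|]; last by rewrite mulr0.
    by case/eqP: ne_ki; apply: val_inj; rewrite /= eq_kj def_i.
  rewrite big1 // => k _; rewrite !mxE; case: eqP => [eq_kj|]; last by rewrite mulr0.
  by case/negP: ge_j; rewrite -eq_kj.
apply/setP => x; apply/idP/imsetP => [x_in | [y + ->]]; last first.
  rewrite defC => /imsetP[z _ ->]; rewrite redM mulmxA mulmxK // mulmxA.
  rewrite inE; apply/forallP => j; rewrite nth_mkseq // multiples_gcd // redDE /a.
  case: insubP => [i lt_j _|/negPf->].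
    by rewrite lt_j; apply/multiples_intP; exists ((z *m red _ _ L) 0 i).
  by apply/multiplesP; exists 0; rewrite mul0r.
have z_ex (j : 'I_n) : exists z : 'Z_q,
    x 0 j = if (j < N)%N then z * (d`_j)%:~R else 0.
  move: x_in; rewrite inE => /forallP/(_ j); rewrite nth_mkseq // multiples_gcd // /a.
  case: ltnP => _; first by move/multiples_intP.
  by move=> /multiplesP[z ->]; exists 0; rewrite mulr0.
have [w x_w] := fin_all_exists z_ex.
pose y : 'rV['Z_q]_N := \row_i if insub (nat_of_ord i) is Some j then w j else 0.
have def_x : x = y *m red _ _ D.
  apply/rowP => j; rewrite redDE x_w.
  case: insubP => [i -> def_i | /negPf-> //]; rewrite mxE.
  case: insubP => [k _ def_k|]; last by rewrite def_i ltn_ord.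
  by congr (w _ * _); apply: val_inj; rewrite /= def_k def_i.
exists (x *m red _ _ R); last by rewrite mulmxK.
rewrite defC; apply/imsetP; exists (y *m invmx (red _ _ L)) => //.
by rewrite redM def_x !mulmxA mulmxKV.
Qed.

(** * Balls and perfect codes *)

(** The Lee weight is the least absolute value of an integer representative.
    This form makes the triangle inequality and the injectivity arguments
    statements about integers. *)
Lemma lee_absP q (a : 'Z_q) r : (1 < q)%N ->
  reflect (exists2 z : int, (`|z| <= r)%N & a = z%:~R) (lee_abs a <= r)%N.
Proof.
move=> q_gt1; have a_ltq : (a < q)%N by rewrite -[X in (_ < X)%N]Zp_cast.
rewrite /lee_abs; apply: (iffP idP) => [|[z]].
  rewrite geq_min => /orP[a_le | qa_le].
    by exists (Posz a) => //; rewrite -[LHS]natr_Zp.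
  exists (- (Posz (q - a))); first by rewrite abszN.
  rewrite mulrNz -[_%:~R]/((q - a)%:R) natrB ?(ltnW a_ltq) //.
  by rewrite natr_Zp pchar_Zp // sub0r opprK.
have neg_case k b : (k <= r)%N -> b = - k%:R :> 'Z_q -> (minn b (q - b) <= r)%N.
  move=> k_le def_b; have : (q %| b + k)%N.
    by rewrite -natZq_eq0 // natrD natr_Zp def_b addNr.
  have [b0 _|b_gt0] := posnP b; first by rewrite b0 min0n.
  move=> /dvdn_leq; rewrite addn_gt0 b_gt0 => /(_ isT) le_q.
  by rewrite geq_min; apply/orP; right; rewrite (leq_trans _ k_le) // leq_subLR.
case: (intP z) => [_ ->|k k_le def_a|k k_le def_a].
- by rewrite min0n.
- rewrite geq_min (leq_trans _ k_le) // def_a -[_%:~R]/(k.+1%:R) val_Zp_nat //.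
  exact: leq_mod.
- by apply: neg_case k_le _; rewrite def_a mulrNz.
Qed.

Lemma mem_max_ball q n (x y : 'rV['Z_q]_n) r :
  (y \in max_ball x r) = [forall i, (lee_abs (x 0 i - y 0 i)%R <= r)%N].
Proof.
rewrite inE /max_dist; apply/bigmax_leqP/forallP => [H i|H i _]; exact: H.
Qed.

Lemma card_max_ball q n e (x : 'rV['Z_q]_n) : (1 < q)%N -> (2 * e + 1 <= q)%N ->
  #|max_ball x e| = ((2 * e + 1) ^ n)%N.
Proof.
move=> q_gt1 le_q.
have -> : max_ball x e = [set y : 'rV['Z_q]_n |
    [forall i, y 0 i \in [set b | (lee_abs (x 0 i - b)%R <= e)%N]]].
  apply/setP => y; rewrite mem_max_ball !inE.
  by apply: eq_forallb => i; rewrite inE.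
rewrite card_row_set (eq_bigr (fun=> 2 * e + 1)%N) => [|i _].
  by rewrite prod_nat_const card_ord.
pose shift (k : 'I_(2 * e + 1)) : 'Z_q := x 0 i - (k%:Z - e%:Z)%:~R.
have shift_inj : injective shift.
  move=> k l /(congr1 (fun b => x 0 i - b)); rewrite !subKr => /eqP.
  rewrite -subr_eq0 -rmorphB /= intZq_eq0 // => q_dvd.
  apply/val_inj/eqP/negPn/negP => /= ne_kl.
  have dist_gt0 : (0 < `|(k%:Z - e%:Z - (l%:Z - e%:Z))%R|)%N by lia.
  by have := dvdn_leq dist_gt0 q_dvd; have := ltn_ord k; have := ltn_ord l; lia.
have -> : [set b | (lee_abs (x 0 i - b)%R <= e)%N] = shift @: 'I_(2 * e + 1).
  apply/setP => b; rewrite inE; apply/(lee_absP _ _ q_gt1)/imsetP.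
    move=> [z z_le def_b]; have k_lt : (`|(z + e%:Z)%R| < 2 * e + 1)%N by lia.
    exists (Ordinal k_lt) => //; rewrite /shift /= gez0_abs; last by lia.
    by rewrite addrK -def_b subKr.
  move=> [k _ ->]; exists (k%:Z - e%:Z); last by rewrite subKr.
  by have := ltn_ord k; lia.
by rewrite card_imset // card_ord.
Qed.

Lemma card_cover_balls q n e (C : {set 'rV['Z_q]_n}) :
    (1 < q)%N -> (2 * e + 1 <= q)%N ->
    {in C &, forall c c', c != c' -> [disjoint max_ball c e & max_ball c' e]} ->
  #|\bigcup_(c in C) max_ball c e| = (#|C| * (2 * e + 1) ^ n)%N.
Proof.
move=> q_gt1 le_q dis.
(* The union is extended by empty sets, so that the index runs over all of V. *)
pose F c := if c \in C then max_ball c e else set0.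
have -> : \bigcup_(c in C) max_ball c e = \bigcup_c F c by rewrite big_mkcond.
rewrite -sum1_card partition_disjoint_bigcup => [|c c' ne_cc'].
  under eq_bigr do rewrite sum1_card.
  rewrite -sum_nat_const [RHS]big_mkcond; apply: eq_bigr => c _.
  by rewrite /F; case: ifP => _; rewrite ?cards0 ?card_max_ball.
rewrite /F; case: ifP => [cC|_]; last by rewrite -setI_eq0 set0I.
by case: ifP => [c'C|_]; [apply: dis | rewrite -setI_eq0 setI0].
Qed.

Lemma card_rVZq q n : (1 < q)%N -> #|'rV['Z_q]_n| = (q ^ n)%N.
Proof. by move=> q_gt1; rewrite card_mx mul1n card_ord Zp_cast. Qed.

Lemma perfect_code_card q n e (C : {group 'rV['Z_q]_n}) :
  (1 < q)%N -> (2 * e + 1 <= q)%N -> is_perfect_code e C ->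
  (#|C| * (2 * e + 1) ^ n = q ^ n)%N.
Proof.
move=> q_gt1 le_q /and3P[_ /eqP cover_C /forall_inP dis].
rewrite -card_cover_balls // ?cover_C ?cardsT ?card_rVZq //.
by move=> c c' cC c'C; move/forall_inP: (dis c cC) => /(_ c' c'C)/implyP.
Qed.

(** For a subgroup, disjointness of the balls is the absence of nonzero
    codewords of weight at most 2e, and the cardinality condition then leaves
    no room outside the balls. *)
Lemma separated_perfect_code q n e (C : {group 'rV['Z_q]_n}) :
    (1 < q)%N -> (2 * e + 1 <= q)%N -> (1 < #|C|)%N ->
    (#|C| * (2 * e + 1) ^ n = q ^ n)%N ->
    (forall x, x \in C -> (forall i, lee_abs (x 0 i)%R <= 2 * e)%N -> x = 0) ->
  is_perfect_code e C.
Proof.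
move=> q_gt1 le_q C_gt1 card_C sep.
have dis : {in C &, forall c c', c != c' ->
    [disjoint max_ball c e & max_ball c' e]}.
  move=> c c' cC c'C; apply: contraNT => /pred0Pn[y /andP[]].
  rewrite /= !mem_max_ball => /forallP cy /forallP c'y.
  rewrite -subr_eq0; apply/eqP/sep => [|i]; first exact: groupM cC (groupVr c'C).
  have /(lee_absP _ _ q_gt1)[z z_le def_z] := cy i.
  have /(lee_absP _ _ q_gt1)[z' z'_le def_z'] := c'y i.
  apply/(lee_absP _ _ q_gt1); exists (z - z'); first by lia.
  by rewrite rmorphB /= -def_z -def_z' !mxE opprB addrA subrK.
rewrite /is_perfect_code C_gt1 /=; apply/andP; split.
  by rewrite eqEcard subsetT cardsT card_rVZq // card_cover_balls // card_C /=.
by apply/forall_inP => c cC; apply/forall_inP => c' c'C; apply/implyP/dis.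
Qed.

(** * Perfect codes as kernels of triangular matrices *)

Definition ker_code_set (q n : nat) (T : 'M['Z_q]_n) : {set 'rV['Z_q]_n} :=
  [set x | x *m T == 0].

Lemma ker_code_group_set q n (T : 'M['Z_q]_n) : group_set (ker_code_set T).
Proof.
apply/group_setP; split=> [|x y]; rewrite !inE ?mul0mx // => /eqP xT /eqP yT.
by rewrite FinRing.zmodMgE mulmxDl xT yT addr0.
Qed.

Definition ker_code q n (T : 'M['Z_q]_n) : {group 'rV['Z_q]_n} :=
  Group (ker_code_group_set T).

(** Let j be the last index with x_j nonzero.  Column j of the lower triangular
    system x T = 0 reduces to t x_j = 0 up to sign.  So 2e+1 divides an integer
    representative of x_j of absolute value at most 2e, which is then 0. *)
Lemma trig_ker_separated q n e t (T : 'M['Z_q]_n) (s : 'I_n -> int) :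
    (1 < q)%N -> q = ((2 * e + 1) * t)%N -> is_trig_mx T ->
    (forall i, T i i = (s i)%:~R) -> (forall i, `|s i|%N = t) ->
  forall x, x \in ker_code T -> (forall i, lee_abs (x 0 i)%R <= 2 * e)%N -> x = 0.
Proof.
move=> q_gt1 def_q /is_trig_mxP T_trig T_diag abs_s x; rewrite inE => /eqP xT x_le.
have t_gt0 : (0 < t)%N by case: t def_q {abs_s} q_gt1 => // ->; rewrite muln0.
apply/eqP/negPn/negP => nz_x.
have /existsP[i0 nz_i0] : [exists i, x 0 i != 0].
  apply: contraR nz_x => /existsPn x0; apply/eqP/rowP => i.
  by rewrite mxE; apply/eqP/negPn.
have [j nz_j max_j] := @arg_maxnP _ i0 (fun i => x 0 i != 0) (@nat_of_ord n) nz_i0.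
have /rowP/(_ j) := xT; rewrite !mxE (bigD1 j) //= big1 => [|i ne_ij]; last first.
  have [lt_ij|lt_ji|eq_ij] := ltngtP i j; first by rewrite T_trig ?mulr0.
    have [->|nz_i] := eqVneq (x 0 i) 0; first by rewrite mul0r.
    have le_ij : (i <= j)%N := max_j i nz_i.
    by rewrite leqNgt lt_ji in le_ij.
  by case/eqP: ne_ij; apply: val_inj.
have /(lee_absP _ _ q_gt1)[z z_le def_z] := x_le j.
move/eqP; rewrite addr0 T_diag def_z -rmorphM /= intZq_eq0 // abszM abs_s def_q.
rewrite dvdn_pmul2r // => /dvdn_leq z_dvd; case/eqP: nz_j.
have [z0|z_gt0] := posnP `|z|; last by have := z_dvd z_gt0; lia.
by move/eqP: z0; rewrite absz_eq0 def_z => /eqP->.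
Qed.

Lemma code_iso_card q n (C1 C2 : {group 'rV['Z_q]_n}) :
  code_iso C1 C2 -> #|C1| = #|C2|.
Proof.
by move=> /(code_iso_card_mulrn 1); rewrite !imset_id.
Qed.

Lemma prod_nth_ord (g : seq nat) n (F : nat -> nat) : size g = n ->
  (\prod_(i < n) F (nth 0%N g i) = \prod_(x <- g) F x)%N.
Proof. by move=> <-; rewrite (big_nth 0%N) big_mkord. Qed.

Lemma card_diag_code_dvdn q n g : (1 < q)%N -> size g = n -> all (dvdn^~ q) g ->
  (#|diag_code q (fun i : 'I_n => nth 0%N g i)| * \prod_(x <- g) x = q ^ n)%N.
Proof.
move=> q_gt1 size_g /allP g_q.
rewrite -(card_diag_code (fun i : 'I_n => nth 0%N g i)) //.
congr (_ * _)%N; rewrite -(prod_nth_ord id size_g); apply: eq_bigr => i _.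
by apply/esym/gcdn_idPr/g_q/mem_nth; rewrite size_g.
Qed.

Lemma diag_code_iso_inj q n (g h : seq nat) : (1 < q)%N ->
  size g = n -> size h = n -> sorted dvdn g -> sorted dvdn h ->
  all (dvdn^~ q) g -> all (dvdn^~ q) h ->
  code_iso (diag_code q (fun i : 'I_n => nth 0%N g i))
           (diag_code q (fun i : 'I_n => nth 0%N h i)) -> g = h.
Proof.
move=> q_gt1 size_g size_h g_sorted h_sorted gq hq iso_gh.
apply: (@sorted_gcd_profile_inj q) => //; rewrite ?size_g ?size_h //.
  exact: ltnW.
move=> k.
rewrite -(prod_nth_ord (fun x => gcdn q (k * x)) size_g).
rewrite -(prod_nth_ord (fun x => gcdn q (k * x)) size_h).
have := card_diag_code_mulrn (fun i : 'I_n => nth 0%N g i) k q_gt1.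
rewrite -(card_diag_code_mulrn (fun i : 'I_n => nth 0%N h i) k q_gt1).
rewrite (code_iso_card_mulrn k iso_gh) => /eqP.
rewrite eqn_pmul2l => [/eqP //|].
apply/card_gt0P; exists 0.
apply/imsetP; exists 0; last by rewrite mul0rn.
by apply/diag_codeP; exists (fun=> 0) => i; rewrite mxE mul0r.
Qed.

(** The diagonal code is the kernel of the matrix A with diagonal entries
    q / g_i.  Replacing A by an equivalent triangular matrix P A Q changes the
    kernel only by the automorphism P, and makes it perfect. *)
Lemma perfect_code_of_type q n e t g :
    (1 <= n)%N -> (1 < t)%N -> q = ((2 * e + 1) * t)%N ->
    size g = n -> all (dvdn^~ q) g -> (\prod_(x <- g) x = (2 * e + 1) ^ n)%N ->
  exists2 C, C \in LPL n e q &
    code_iso (diag_code q (fun i : 'I_n => nth 0%N g i)) C.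
Proof.
move=> n_ge1 t_gt1 def_q size_g gq prod_g; set a := fun i : 'I_n => _.
have m_gt0 : (0 < 2 * e + 1)%N by rewrite addn1.
have q_gt1 : (1 < q)%N by rewrite def_q (leq_trans t_gt1) // leq_pmull.
have le_mq : (2 * e + 1 <= q)%N by rewrite def_q leq_pmulr // ltnW.
have t_gt0 : (0 < t)%N by apply: ltnW.
have aq i : (a i %| q)%N by move/allP: gq; apply; rewrite mem_nth ?size_g.
pose A : 'M[int]_n := diag_mx (\row_i (q %/ a i)%:Z).
have det_A : `|\det A|%N = (t ^ n)%N.
  rewrite det_diag (big_morph absz abszM (erefl _)).
  rewrite (eq_bigr (fun i => q %/ a i)%N) => [|i _]; last by rewrite mxE.
  apply/eqP; rewrite -(@eqn_pmul2r ((2 * e + 1) ^ n)) ?expn_gt0 ?m_gt0 //.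
  rewrite -expnMn [(t * _)%N]mulnC -def_q -prod_g -(prod_nth_ord id size_g).
  rewrite -big_split (eq_bigr (fun=> q)) => [|i _] /=; last by rewrite divnK.
  by rewrite prod_nat_const card_ord.
have [P [Q [P_unit Q_unit PQ_trig PQ_diag]]] := unimodular_trig t_gt0 det_A.
pose red (M : 'M[int]_n) := map_mx (intr : int -> 'Z_q) M.
pose T := red (P *m A *m Q).
have uP : red P \in unitmx by apply: map_intr_unitmx.
have uQ : red Q \in unitmx by apply: map_intr_unitmx.
have redA (y : 'rV_n) : (y *m red A == 0) = (y \in diag_code q a).
  rewrite /red /A map_diag_mx mul_mx_diag.
  have coordE i : (y 0 i * (q %/ a i)%:R == 0) = (y 0 i \in multiples q (a i)).
    have a_gt0 : (0 < a i)%N by exact: dvdn_gt0 (ltnW q_gt1) (aq i).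
    apply/idP/multiplesP => [|[z ->]]; last first.
      by rewrite -mulrA -natrM mulnC divnK // pchar_Zp // mulr0.
    rewrite -[y 0 i]natr_Zp -natrM natZq_eq0 // -{1}(divnK (aq i)) mulnC.
    rewrite dvdn_pmul2r ?divn_dvd_gt0 // ?(ltnW q_gt1) // => /dvdnP[b ->].
    by exists b%:R; rewrite natrM.
  rewrite inE; apply/eqP/forallP => [/rowP y0 i | y_in].
    by rewrite -coordE; have := y0 i; rewrite !mxE => ->.
  by apply/rowP => i; rewrite !mxE; apply/eqP; rewrite coordE.
have iso : code_iso (diag_code q a) (ker_code T).
  apply: (code_iso_mulmx (R := red P)) => //; apply/setP => y.
  have redT x : (x *m T == 0) = (x *m red P *m red A == 0).
    rewrite -[RHS](inj_eq (can_inj (mulmxK uQ))) mul0mx.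
    by rewrite /T /red !map_mxM !mulmxA.
  rewrite -redA; apply/idP/imsetP => [y0 | [x + ->]].
    exists (y *m invmx (red P)); last by rewrite (mulmxKV uP).
    by rewrite inE redT (mulmxKV uP).
  by rewrite inE redT.
exists (ker_code T) => //; rewrite inE.
have card_T : (#|ker_code T| * (2 * e + 1) ^ n = q ^ n)%N.
  by rewrite -(code_iso_card iso) -prod_g card_diag_code_dvdn.
apply: separated_perfect_code => //.
  rewrite -(ltn_pmul2r (_ : 0 < (2 * e + 1) ^ n)%N) ?expn_gt0 ?m_gt0 //.
  have tn_gt1 : (1 < t ^ n)%N by rewrite -(exp1n n) ltn_exp2r.
  by rewrite card_T mul1n def_q expnMn ltn_Pmulr // expn_gt0 m_gt0.
apply: (trig_ker_separated (s := fun i => (P *m A *m Q) i i) q_gt1 def_q) => //.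
  apply/is_trig_mxP => i j lt_ij; rewrite mxE.
  by move/is_trig_mxP: PQ_trig => /(_ i j lt_ij)->.
by move=> i; rewrite mxE.
Qed.

(** * Counting the classes *)

(** The map that sends a chain to the class of the perfect codes equivalent to
    its diagonal code is a bijection onto the classes. *)
Lemma card_code_classes n e t q :
    (1 <= n)%N -> (1 < t)%N -> q = ((2 * e + 1) * t)%N ->
    ((2 * e + 1) ^ (n - 1) %| t)%N ->
  #|code_classes n e q| = size (divisor_chains n ((2 * e + 1) ^ n)).
Proof.
move=> n_ge1 t_gt1 def_q m_t; set N := ((2 * e + 1) ^ n)%N.
have m_gt0 : (0 < 2 * e + 1)%N by rewrite addn1.
have N_gt0 : (0 < N)%N by rewrite expn_gt0 m_gt0.
have q_gt1 : (1 < q)%N by rewrite def_q (leq_trans t_gt1) // leq_pmull.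
have le_mq : (2 * e + 1 <= q)%N by rewrite def_q leq_pmulr // ltnW.
have N_q : (N %| q)%N.
  by rewrite /N -(subnK n_ge1) expnD expn1 mulnC def_q dvdn_pmul2l.
have chainP g : g \in divisor_chains n N -> [/\ size g = n, sorted dvdn g,
    all (dvdn^~ q) g & (\prod_(x <- g) x = N)%N].
  rewrite mem_divisor_chains // => /and3P[/eqP size_g g_sorted /eqP prod_g].
  split=> //; apply/allP => x x_g; apply: dvdn_trans N_q.
  by rewrite -prod_g (big_rem x) //= dvdn_mulr.
pose dc g := diag_code q (fun i : 'I_n => nth 0%N g i).
pose class g := [set C in LPL n e q | code_iso (dc g) C].
have iso_trans C1 C2 C3 : code_iso C1 C2 ->
    code_iso C1 C3 = code_iso (q := q) (n := n) C2 C3.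
  by have [_] := @code_iso_equiv q n C1 C2 C3; apply.
have iso_sym C1 C2 : code_iso C1 C2 -> code_iso (q := q) (n := n) C2 C1.
  move=> iso12; rewrite -(iso_trans _ _ _ iso12).
  by have [] := @code_iso_equiv q n C1 C1 C1.
have classE g C : code_iso (dc g) C ->
    class g = [set C' in LPL n e q | code_iso C C'].
  by move=> iso_gC; apply/setP => C'; rewrite !inE (iso_trans _ _ _ iso_gC).
have class_uniq : uniq (map class (divisor_chains n N)).
  rewrite map_inj_in_uniq ?divisor_chains_uniq // => g h.
  move=> /chainP[size_g g_sorted gq prod_g] /chainP[size_h h_sorted hq _] eq_gh.
  have [C C_perf iso_gC] := perfect_code_of_type n_ge1 t_gt1 def_q size_g gq prod_g.
  have : C \in class h by rewrite -eq_gh inE C_perf.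
  rewrite inE => /andP[_ iso_hC].
  apply: (@diag_code_iso_inj q n) => //.
  by rewrite (iso_trans _ _ _ iso_gC); apply: iso_sym.
rewrite -(size_map class) -(card_uniqP class_uniq); apply: eq_card => X.
apply/imsetP/mapP => [[C C_perf ->]|[g g_in ->]].
  have [g [size_g g_sorted gq iso_gC]] := code_iso_diag C q_gt1.
  exists g; last by rewrite (classE _ _ iso_gC).
  rewrite mem_divisor_chains // size_g eqxx g_sorted /=.
  have dc_gt0 : (0 < #|dc g|)%N by apply: cardG_gt0.
  rewrite -(eqn_pmul2l dc_gt0) card_diag_code_dvdn // (code_iso_card iso_gC).
  by move: C_perf; rewrite inE => /(perfect_code_card q_gt1 le_mq)->.
have [size_g g_sorted gq prod_g] := chainP g g_in.
have [C C_perf iso_gC] := perfect_code_of_type n_ge1 t_gt1 def_q size_g gq prod_g.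
by exists C => //; rewrite (classE _ _ iso_gC).
Qed.

(** * Small dimensions *)

Lemma partition_count1 s : partition_count 1 s = 1%N.
Proof. by elim: s => [|s IHs]; rewrite partition_countS ?subn1 ?IHs. Qed.

Lemma partition_count2 s : partition_count 2 s = (s./2).+1.
Proof.
elim/ltn_ind: s => -[|[|s]] IHs; rewrite partition_countS partition_count1 //.
by rewrite !subSS subn0 IHs //= add1n.
Qed.

(** The parity term is the distance of 3 (v+1)^2 to the next multiple of 4. *)
Lemma partition_count3_mul3 v :
  (4 * partition_count 3 (3 * v) = 3 * v.+1 ^ 2 + ~~ odd v)%N.
Proof.
elim: v => [|v IHv]; first by rewrite partition_countS partition_count2.
rewrite partition_countS partition_count2 mulnS leq_addr addKn mulnDr IHv.
have := odd_double_half (3 + 3 * v); rewrite oddD oddM /= -muln2 -!mulnn.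
by case: (odd v) => /=; lia.
Qed.

Lemma nearest_int_quarter v :
  nearest_int (3%:R / 4%:R * (v.+1)%:R ^+ 2) = (partition_count 3 (3 * v))%:Z.
Proof.
apply: floor_def.
have := congr1 (fun k => k%:R : rat) (partition_count3_mul3 v).
rewrite natrM natrD natrM natrX intrD -![(Posz _)%:~R]/(_%:R).
by case: (odd v) => /=; lra.
Qed.

Lemma logn_primes_square_free N p : (0 < N)%N -> square_free N ->
  p \in primes N -> logn p N = 1%N.
Proof.
move=> N_gt0 sqf; rewrite mem_primes => /and3P[p_pr _ p_dvd].
apply/eqP; rewrite eqn_leq -{2}(pfactorK 1 p_pr) expn1 dvdn_leq_log // andbT.
rewrite leqNgt; apply/negP => lt_1; have := sqf p; rewrite pfactor_dvdn //.
by move=> /(_ lt_1) p1; rewrite p1 in p_pr.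
Qed.

Theorem corollary5p37 (n e t q : nat)
    (n_ge1 : (1 <= n)%N) (t_gt1 : (1 < t)%N)
    (q_def : q = ((2 * e + 1) * t)%N)
    (dvd_t : ((2 * e + 1) ^ (n - 1) %| t)%N) :
  [/\ (#|code_classes n e q|%:Z =
         \prod_(p <- primes (2 * e + 1))
            coef_inv (\prod_(1 <= k < n.+1) (1 - 'X^k))
                     (n * logn p (2 * e + 1))),
      (n = 2%N ->
         [/\ #|code_classes n e q|%:Z =
               \prod_(p <- primes (2 * e + 1))
                  coef_inv ((1 - 'X) * (1 - 'X^2)) (2 * logn p (2 * e + 1)),
             \prod_(p <- primes (2 * e + 1))
                  coef_inv ((1 - 'X) * (1 - 'X^2)) (2 * logn p (2 * e + 1)) =
               \prod_(p <- primes (2 * e + 1)) ((logn p (2 * e + 1)).+1)%:Z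
           & \prod_(p <- primes (2 * e + 1)) ((logn p (2 * e + 1)).+1)%:Z =
               (size (divisors (2 * e + 1)))%:Z]),
      (n = 3%N ->
         #|code_classes n e q|%:Z =
           \prod_(p <- primes (2 * e + 1))
              coef_inv ((1 - 'X) * (1 - 'X^2) * (1 - 'X^3))
                       (3 * logn p (2 * e + 1)) /\
         \prod_(p <- primes (2 * e + 1))
              coef_inv ((1 - 'X) * (1 - 'X^2) * (1 - 'X^3))
                       (3 * logn p (2 * e + 1)) =
           \prod_(p <- primes (2 * e + 1))
              nearest_int (3%:R / 4%:R * ((logn p (2 * e + 1)).+1)%:R ^+ 2))
    & (n = 3%N -> square_free (2 * e + 1) ->
         #|code_classes n e q| = 3 ^ size (primes (2 * e + 1)))%N].
Proof.
set m := (2 * e + 1)%N; have m_gt0 : (0 < m)%N by rewrite /m addn1.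
have card_nat : #|code_classes n e q| =
    (\prod_(p <- primes m) partition_count n (n * logn p m))%N.
  rewrite (card_code_classes n_ge1 t_gt1 q_def dvd_t) -/m.
  rewrite size_divisor_chainsE ?expn_gt0 ?m_gt0 // primesX //.
  by apply: eq_bigr => p _; rewrite lognX.
have card_coef : #|code_classes n e q|%:Z =
    \prod_(p <- primes m)
       coef_inv (\prod_(1 <= k < n.+1) (1 - 'X^k)) (n * logn p m).
  rewrite card_nat (big_morph Posz PoszM (erefl _)).
  by apply: eq_bigr => p _; rewrite coef_inv_partition_count.
have prod2 : \prod_(1 <= k < 3) (1 - 'X^k) = (1 - 'X) * (1 - 'X^2) :> {poly int}.
  by rewrite /index_iota /= !big_cons big_nil mulr1 expr1.
have prod3 : \prod_(1 <= k < 4) (1 - 'X^k) =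
    (1 - 'X) * (1 - 'X^2) * (1 - 'X^3) :> {poly int}.
  by rewrite /index_iota /= !big_cons big_nil mulr1 expr1 mulrA.
split=> [//|n2|n3|n3 sqf].
- rewrite card_coef n2 prod2; split=> //.
    apply: eq_bigr => p _; rewrite -prod2 coef_inv_partition_count partition_count2.
    by rewrite mul2n doubleK.
  by rewrite size_divisorsE // (big_morph Posz PoszM (erefl _)).
- rewrite card_coef n3 prod3; split=> //.
  apply: eq_bigr => p _.
  by rewrite -prod3 coef_inv_partition_count nearest_int_quarter.
rewrite card_nat n3 (eq_big_seq (fun=> 3)) => [|p p_m].
  by rewrite big_const_seq count_predT iter_muln_1.
rewrite (logn_primes_square_free m_gt0 sqf p_m).
by apply/eqP; rewrite -(@eqn_pmul2l 4) // partition_count3_mul3.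
Qed.
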